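(* Let $H$ be the infinite-dimensional Heisenberg Lie algebra. Any $\mathbb Z$-graded irreducible diagonal $H$-module $V$ of nonzero level has a $\mathbb Z^\infty$-gradation $V=\bigoplus_{\bar k\in\mathbb Z^\infty}V_{\bar k}$.
   Context: $H=\mathbb Cc\oplus\bigoplus_{i\in\mathbb Z\setminus\{0\}}\mathbb Ce_i$ is the complex Lie algebra with $c$ central, $[e_i,e_{-i}]=c$ for $i\ge1$, and $[e_i,e_j]=0$ if $i+j\ne0$. A module has level $a$ if $c$ acts as the scalar $a\in\mathbb C$. An $H$-module $V$ is $\mathbb Z$-graded if $V=\bigoplus_{j\in\mathbb Z}V_j$ with $e_iV_j\subseteq V_{i+j}$ for all $i,j$. It is diagonal if some nonzero vector of $V$ is a common eigenvector of $e_ie_{-i}$ for all $i\in\mathbb Z\setminus\{0\}$. $\mathbb Z^\infty$ is the group of integer sequences $\bar k=(k_1,k_2,\dots)$ with only finitely many nonzero entries. A $\mathbb Z^\infty$-gradation of an $H$-module $V$ is a decomposition $V=\bigoplus_{\bar k\in\mathbb Z^\infty}V_{\bar k}$ such that $e_{j}V_{\bar k}\subseteq V_{\bar k+\zeta_j}$ and $e_{-j}V_{\bar k}\subseteq V_{\bar k-\zeta_j}$ for all $j\ge1$ and all $\bar k\in\mathbb Z^\infty$, where $\zeta_j$ has $1$ in the $j$th place and $0$ elsewhere. *)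

(* Defs.v *)
From HB Require Import structures.
From mathcomp Require Import all_boot all_order all_algebra.
From mathcomp Require Import finmap boolp classical_sets reals complex monalg.
Set Implicit Arguments.
Unset Strict Implicit.
Unset Printing Implicit Defensive.
Import Order.TTheory GRing.Theory Num.Theory.
Local Open Scope classical_set_scope.
Local Open Scope ring_scope.

(** * Lie algebras and their modules *)

Record lieAlgebra (K : fieldType) := LieAlgebra {
  lie_sort :> lmodType K;
  bracket : lie_sort -> lie_sort -> lie_sort;
  bracket_linearl : forall a x y z,
    bracket (a *: x + y) z = a *: bracket x z + bracket y z;
  bracket_linearr : forall a x y z,
    bracket x (a *: y + z) = a *: bracket x y + bracket x z;
  bracketxx : forall x, bracket x x = 0;
  bracket_jacobi : forall x y z,
    bracket x (bracket y z) + bracket y (bracket z x)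
      + bracket z (bracket x y) = 0 }.

Record lieModule (K : fieldType) (L : lieAlgebra K) := LieModule {
  lmod_sort :> lmodType K;
  act : L -> lmod_sort -> lmod_sort;
  act_linearl : forall a x y v, act (a *: x + y) v = a *: act x v + act y v;
  act_linearr : forall a x u v, act x (a *: u + v) = a *: act x u + act x v;
  act_bracket : forall x y v,
    act (bracket x y) v = act x (act y v) - act y (act x v) }.

Definition subspace (K : fieldType) (V : lmodType K) (U : set V) : Prop :=
  U 0 /\ forall (a : K) (u v : V), U u -> U v -> U (a *: u + v).

Definition submodule (K : fieldType) (L : lieAlgebra K) (V : lieModule L)
    (U : set V) : Prop :=
  subspace U /\ forall (x : L) (v : V), U v -> U (act x v).

Definition irreducible_module (K : fieldType) (L : lieAlgebra K) (V : lieModule L) :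
    Prop :=
  (exists v : V, v != 0) /\
  forall U : set V, submodule U -> U = [set 0] \/ U = setT.

(* [V] is the internal direct sum of the subspaces [W i]: [{malg V[I]}] is the
   type of finitely supported families [I -> V], so every vector is uniquely a
   finite sum of elements of the [W i]. *)
Definition direct_sum (K : fieldType) (V : lmodType K) (I : choiceType)
    (W : I -> set V) : Prop :=
  (forall i, subspace (W i)) /\
  forall v : V, exists! f : {malg V[I]},
    (forall i, W i f@_i) /\ v = \sum_(i <- msupp f) f@_i.

(** * The infinite-dimensional Heisenberg Lie algebra *)

Section Heisenberg.
Variable K : fieldType.

(* The basis is indexed by [int]: the vector of index [0] is the central
   element [c], and the vector of index [i != 0] is [e_i]. *)
Let H := {malg K[int]}.
Implicit Types x y z : H.

(* The form [heis_half x y - heis_half y x] is the coefficient of [c] in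
   [[x, y]]: it sends (e_i, e_{-i}) to 1 for [i >= 1]. *)
Definition heis_half x y : K :=
  \sum_(i <- msupp x | 0 < i) x@_i * y@_(- i).

Definition heis_bracket x y : H :=
  (heis_half x y - heis_half y x) *: << 0 >>.

Lemma heis_halfEw (D : {fset int}) x y : (msupp x `<=` D)%fset ->
  heis_half x y = \sum_(i <- D | 0 < i) x@_i * y@_(- i).
Proof.
move=> sD; rewrite /heis_half big_mkcond [RHS]big_mkcond /=.
apply: big_fset_incl => // i _ /mcoeff_outdom ->.
by rewrite mul0r if_same.
Qed.

Lemma heis_half_linearl a x y z :
  heis_half (a *: x + y) z = a * heis_half x z + heis_half y z.
Proof.
pose D := (msupp x `|` msupp y)%fset.
rewrite !(@heis_halfEw D) ?fsubsetUl ?fsubsetUr //.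
  rewrite mulr_sumr -big_split /=; apply: eq_bigr => i _.
  by rewrite mcoeffD mcoeffZ mulrDl mulrA.
apply: fsubset_trans (msuppD_le _ _) _.
by rewrite fsetSU ?msuppZ_le.
Qed.

Lemma heis_half_linearr a x y z :
  heis_half x (a *: y + z) = a * heis_half x y + heis_half x z.
Proof.
rewrite mulr_sumr -big_split /=; apply: eq_bigr => i _.
by rewrite mcoeffD mcoeffZ mulrDr mulrCA.
Qed.

Lemma heis_bracket_linearl a x y z :
  heis_bracket (a *: x + y) z = a *: heis_bracket x z + heis_bracket y z.
Proof.
rewrite /heis_bracket heis_half_linearl heis_half_linearr scalerA -scalerDl.
by congr (_ *: _); rewrite mulrBr opprD addrACA.
Qed.

Lemma heis_bracket_linearr a x y z :
  heis_bracket x (a *: y + z) = a *: heis_bracket x y + heis_bracket x z.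
Proof.
rewrite /heis_bracket heis_half_linearl heis_half_linearr scalerA -scalerDl.
by congr (_ *: _); rewrite mulrBr opprD addrACA.
Qed.

Lemma heis_bracketxx x : heis_bracket x x = 0.
Proof. by rewrite /heis_bracket subrr scale0r. Qed.

Lemma heis_halfU (i j : int) :
  heis_half << i >> << j >> = ((0 < i) && (j == - i))%:R.
Proof.
rewrite /heis_half big_mkcond /= msuppU oner_eq0 big_seq_fset1.
by rewrite !mcoeffU eqxx mul1r; case: (0 < i).
Qed.

Lemma heis_half_cl a y : heis_half (a *: << 0 >>) y = 0.
Proof.
rewrite (@heis_halfEw [fset 0%R]%fset) ?big_mkcond ?big_seq_fset1 //.
exact: fsubset_trans (msuppZ_le _ _) msuppU_le.
Qed.

Lemma heis_half_cr a x : heis_half x (a *: << 0 >>) = 0.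
Proof.
rewrite /heis_half big1 // => i i_gt0.
by rewrite mcoeffZ mcoeffU eq_sym oppr_eq0 gt_eqF // mulr0n !mulr0.
Qed.

Lemma heis_bracket_c a x : heis_bracket x (a *: << 0 >>) = 0.
Proof. by rewrite /heis_bracket heis_half_cl heis_half_cr subrr scale0r. Qed.

Lemma heis_jacobi x y z :
  heis_bracket x (heis_bracket y z) + heis_bracket y (heis_bracket z x)
    + heis_bracket z (heis_bracket x y) = 0.
Proof. by rewrite !heis_bracket_c !addr0. Qed.

Definition heisenberg : lieAlgebra K :=
  @LieAlgebra K H heis_bracket heis_bracket_linearl heis_bracket_linearr
    heis_bracketxx heis_jacobi.

Definition heis_c : heisenberg := << 0 >> : H.

(* Meaningful for [i != 0] only: [heis_e 0] is [heis_c]. *)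
Definition heis_e (i : int) : heisenberg := << i >> : H.

Lemma heis_c_central (x : heisenberg) : bracket x heis_c = 0.
Proof. by rewrite -(heis_bracket_c 1 x) scale1r. Qed.

Lemma heis_e_bracket (i : int) : 0 < i ->
  bracket (heis_e i) (heis_e (- i)) = heis_c.
Proof.
move=> i_gt0; rewrite /= /heis_bracket !heis_halfU i_gt0 eqxx oppr_gt0.
by rewrite (lt_gtF i_gt0) subr0 scale1r.
Qed.

Lemma heis_e_bracket0 (i j : int) : i + j != 0 ->
  bracket (heis_e i) (heis_e j) = 0.
Proof.
rewrite addr_eq0 => ij; rewrite /= /heis_bracket !heis_halfU.
by rewrite -eqr_oppLR eq_sym (negbTE ij) !andbF subrr scale0r.
Qed.

End Heisenberg.

(** * Modules over the Heisenberg algebra *)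

(* The group of finitely supported integer sequences, with unit vectors
   [<< j >>]. Positions are counted from 0, so position [j] is attached to
   [e_{j+1}] and [e_{-(j+1)}]. *)
Notation Zinf := {malg int[nat]}.

Section HeisenbergModules.
Variables (K : fieldType) (V : lieModule (heisenberg K)).

Definition has_level (a : K) : Prop := forall v : V, act (heis_c K) v = a *: v.

Definition is_Z_gradation (W : int -> set V) : Prop :=
  direct_sum W /\
  forall (i j : int) (v : V), i != 0 -> W j v -> W (i + j) (act (heis_e K i) v).

Definition Z_graded : Prop := exists W : int -> set V, is_Z_gradation W.

Definition diagonal_module : Prop :=
  exists2 v : V, v != 0 &
    forall i : int, i != 0 ->
      exists lam : K, act (heis_e K i) (act (heis_e K (- i)) v) = lam *: v.

Definition is_Zinf_gradation (W : Zinf -> set V) : Prop :=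
  direct_sum W /\
  forall (j : nat) (k : Zinf) (v : V), W k v ->
    W (k + << j >>) (act (heis_e K j.+1%:Z) v) /\
    W (k - << j >>) (act (heis_e K (- j.+1%:Z)) v).

End HeisenbergModules.

(* Main.v *)
(** The operators [N_i = e_i e_{-i}], [i >= 1], satisfy
    [N_i e_i = e_i (N_i - a)], [N_i e_{-i} = e_{-i} (N_i + a)] and commute with
    [e_j] for [j <> i, -i]. If [N_i v = lam_i v] for all [i], the space
    [V_k] of joint eigenvectors with eigenvalues [lam_i - a k_i] is therefore
    mapped to [V_{k + zeta_j}] by [e_j] and to [V_{k - zeta_j}] by [e_{-j}].
    As [a] is nonzero, distinct [k] give distinct systems of eigenvalues, so the
    sum of the [V_k] is direct; it is a submodule containing [v], hence is the
    whole of [V]. *)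

Require Import Defs.
From HB Require Import structures.
From mathcomp Require Import all_boot all_order all_algebra.
From mathcomp Require Import finmap.
From mathcomp Require Import boolp classical_sets reals complex monalg.
Local Open Scope ring_scope.
Local Open Scope complex_scope.
Set Implicit Arguments.
Unset Strict Implicit.
Unset Printing Implicit Defensive.
Import Order.TTheory GRing.Theory Num.Theory.

(** Registering [act x] as linear makes composites such as [number_op] linear maps too. *)
HB.instance Definition _ (K : fieldType) (L : lieAlgebra K) (V : lieModule L)
    (x : L) :=
  GRing.isLinear.Build K V V *:%R (act x)
    (fun a u v => @act_linearr K L V a x u v).

Section LieModuleTheory.
Variables (K : fieldType) (L : lieAlgebra K) (V : lieModule L).
Implicit Types (x y : L) (v : V).

Lemma actDl x y v : act (x + y) v = act x v + act y v.
Proof. by rewrite -[x]scale1r act_linearl !scale1r. Qed.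

Lemma act0l v : act (0 : L) v = 0.
Proof. by apply: (addrI (act 0 v)); rewrite -actDl !addr0. Qed.

Lemma actZl a x v : act (a *: x) v = a *: act x v.
Proof. by rewrite -[a *: x]addr0 act_linearl act0l addr0. Qed.

Lemma act_suml (I : Type) (r : seq I) (F : I -> L) v :
  act (\sum_(i <- r) F i) v = \sum_(i <- r) act (F i) v.
Proof.
by rewrite (big_morph (fun x => act x v) (id1 := 0) (op1 := +%R)) //
   => [x y|]; rewrite ?actDl ?act0l.
Qed.

Lemma act_comm x y v : bracket x y = 0 -> act x (act y v) = act y (act x v).
Proof.
by move=> xy0; apply/eqP; rewrite -subr_eq0 -act_bracket xy0 act0l.
Qed.

End LieModuleTheory.

Section FiniteFamilies.
Variables (V : zmodType) (I : choiceType).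
Implicit Types f g : {malg V[I]}.

Definition msum f : V := \sum_(i <- msupp f) f@_i.

(** Padding by zero coefficients lets two families be summed over a common support. *)
Lemma msumEw (D : {fset I}) f : (msupp f `<=` D)%fset ->
  msum f = \sum_(i <- D) f@_i.
Proof. by move=> sD; apply: big_fset_incl => // i _ /mcoeff_outdom. Qed.

Lemma msumD f g : msum (f + g) = msum f + msum g.
Proof.
rewrite !(@msumEw (msupp f `|` msupp g)%fset) ?fsubsetUl ?fsubsetUr ?msuppD_le //.
by rewrite -big_split; apply: eq_bigr => i _; rewrite mcoeffD.
Qed.

Lemma msumU i (v : V) : msum << v *g i >> = v.
Proof. by rewrite (msumEw msuppU_le) big_seq_fset1 mcoeffUU. Qed.

Lemma msum0 : msum 0 = 0.
Proof. by rewrite /msum msupp0 big_seq_fset0. Qed.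

End FiniteFamilies.

(** Uniqueness is the injectivity hypothesis. For existence, the summands in [s] are sorted by
    index, those sharing an index being added together. *)
Lemma direct_sum_span (K : fieldType) (V : lmodType K) (I : choiceType)
    (W : I -> set V) :
  (forall i, subspace (W i)) ->
  (forall f g : {malg V[I]}, (forall i, W i f@_i) -> (forall i, W i g@_i) ->
     msum f = msum g -> f = g) ->
  (forall v, exists2 s : seq V,
     forall x, x \in s -> exists i, W i x & v = \sum_(x <- s) x) ->
  direct_sum W.
Proof.
move=> subW injW spanW; split=> // v.
have WD i u w : W i u -> W i w -> W i (u + w).
  by move=> Wu Ww; rewrite -[u]scale1r; apply: (subW i).2.
have [s Ws ->] := spanW v.
suff [f [Wf Df]] : exists f : {malg V[I]},
    (forall i, W i f@_i) /\ \sum_(x <- s) x = msum f.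
  by exists f; split=> // g [Wg Dg]; apply: injW => //; rewrite -Df Dg.
elim: s Ws => [_|x s IHs Ws].
  exists 0; split=> [i|]; first by rewrite mcoeff0; apply: (subW i).1.
  by rewrite big_nil msum0.
have [|f [Wf Df]] := IHs; first by move=> y sy; apply: Ws; rewrite inE sy orbT.
have [i0 Wx] := Ws x (mem_head _ _).
exists (<< x *g i0 >> + f); split=> [i|]; last first.
  by rewrite big_cons msumD msumU Df.
rewrite mcoeffD mcoeffU; apply: WD => //.
by case: eqP => [<- //|_]; apply: (subW i).1.
Qed.

Section JointEigenspaces.
Variables (K : fieldType) (V : lmodType K) (I : choiceType) (J : Type).
Variables (T : J -> {linear V -> V}) (mu : J -> I -> K).

Definition joint_eigenspace (k : I) : set V :=
  fun v => forall j, T j v = mu j k *: v.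

Lemma joint_eigenspace_subspace k : subspace (joint_eigenspace k).
Proof.
split=> [j|a u v Wu Wv j]; first by rewrite linear0 scaler0.
by rewrite linearP Wu Wv scalerDr !scalerA mulrC.
Qed.

Hypothesis mu_sep : forall k l, k != l -> exists j, mu j k != mu j l.

(* Applying [T j - mu j k] kills the [k]-component of a vanishing sum and
   multiplies the [l]-component by [mu j l - mu j k]. *)
Lemma joint_eigenspace_free (s : seq I) (x : I -> V) : uniq s ->
  (forall k, joint_eigenspace k (x k)) -> \sum_(k <- s) x k = 0 ->
  forall k, k \in s -> x k = 0.
Proof.
elim: s x => // k s IHs x /andP[ks us] Wx; rewrite big_cons => sum0.
have xs l : l \in s -> x l = 0.
  move=> sl; have [|j mukl] := mu_sep (k := l) (l := k).
    by apply: contraNneq ks => <-.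
  pose y m := (mu j m - mu j k) *: x m.
  suff /eqP : y l = 0 by rewrite scaler_eq0 subr_eq0 (negbTE mukl) => /eqP.
  apply: IHs => // [m i|].
    by rewrite /y linearZ /= Wx !scalerA mulrC.
  have: T j (x k + \sum_(m <- s) x m) - mu j k *: (x k + \sum_(m <- s) x m) = 0.
    by rewrite sum0 linear0 scaler0 subr0.
  rewrite linearD scalerDr Wx opprD addrACA subrr add0r.
  rewrite linear_sum scaler_sumr -sumrB => sumT0.
  by rewrite -[RHS]sumT0; apply: eq_bigr => m _; rewrite Wx -scalerBl.
move=> l; rewrite inE => /predU1P[-> | /xs //].
by rewrite big1_seq ?addr0 in sum0 => // m /andP[_ /xs].
Qed.

Lemma joint_eigenspace_inj (f g : {malg V[I]}) :
  (forall k, joint_eigenspace k f@_k) -> (forall k, joint_eigenspace k g@_k) ->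
  msum f = msum g -> f = g.
Proof.
move=> Wf Wg Dfg; apply/malgP => k; apply/eqP; rewrite -subr_eq0.
pose D := (msupp f `|` msupp g)%fset.
have [Dk | ] := boolP (k \in D); last first.
  by rewrite in_fsetU => /norP[/mcoeff_outdom-> /mcoeff_outdom->]; rewrite subrr.
(* The differences of components are joint eigenvectors with vanishing sum over [D]. *)
apply/eqP; pose x l := f@_l - g@_l.
apply: (joint_eigenspace_free (s := D) (x := x)) => // [l|]; rewrite /x.
  rewrite addrC -scaleN1r.
  by apply: (joint_eigenspace_subspace l).2; [apply: Wg | apply: Wf].
by rewrite sumrB -!msumEw ?fsubsetUl ?fsubsetUr // Dfg subrr.
Qed.

End JointEigenspaces.

Section HeisenbergAction.
Variables (K : fieldType) (V : lieModule (heisenberg K)) (a : K).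
Hypothesis levelV : has_level V a.
Implicit Types (i j : int) (v : V).

Lemma heis_e_comm i j v : i + j != 0 ->
  act (heis_e K i) (act (heis_e K j) v) = act (heis_e K j) (act (heis_e K i) v).
Proof. by move=> ij; apply: act_comm; apply: heis_e_bracket0. Qed.

Lemma heis_e_swap i v : 0 < i ->
  act (heis_e K i) (act (heis_e K (- i)) v) =
  act (heis_e K (- i)) (act (heis_e K i) v) + a *: v.
Proof.
move=> i_gt0; apply/eqP; rewrite addrC -subr_eq -act_bracket heis_e_bracket //.
by rewrite levelV.
Qed.

(** Each element of the algebra is a finite combination of the [e_i] and of [c], stored at index 0,
    which acts by the scalar [a]. *)
Lemma submodule_heis_e (U : set V) : subspace U ->
  (forall i v, i != 0 -> U v -> U (act (heis_e K i) v)) -> submodule U.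
Proof.
move=> sU Ue; split=> // x v Uv.
have Dx : x = \sum_(i <- msupp x) x@_i *: heis_e K i.
  rewrite {1}[x]monalgE; apply: eq_bigr => i _; apply/malgP => j.
  by rewrite mcoeffZ !mcoeffU mulr_natr.
rewrite Dx act_suml; elim/big_rec: _ => [|i u _ Uu]; first exact: sU.1.
rewrite actZl; apply: sU.2 => //; have [->|/Ue] := eqVneq i 0; last exact.
rewrite [act _ _]levelV -[a *: v]addr0; apply: sU.2 => //; exact: sU.1.
Qed.

(** With positions counted from 0, this is [N_{i+1}]. *)
Definition number_op (i : nat) : {linear V -> V} :=
  act (heis_e K i.+1%:Z) \o act (heis_e K (- i.+1%:Z)).

Variable lam : nat -> K.

Definition weight (i : nat) (k : Zinf) : K := lam i - a * (k@_i)%:~R.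

Definition weight_space : Zinf -> set V := joint_eigenspace number_op weight.

Lemma weight_space_raise (j : nat) k v : weight_space k v ->
  weight_space (k + << j >>) (act (heis_e K j.+1%:Z) v).
Proof.
move=> Wv i; rewrite /weight mcoeffD mcoeffU; move: (Wv i).
rewrite /number_op /= /weight => Wi.
(* For [j != i] the new operator commutes with both factors of [number_op i]. *)
case: (eqVneq j i) => [-> | ji]; last first.
  rewrite mulr0n addr0 (heis_e_comm (i := - _) (j := j.+1%:Z)); last first.
    by rewrite addrC subr_eq0 eqz_nat eqSS.
  rewrite heis_e_comm ?Wi ?linearZ //.
(* For [j = i], the vector [v] is an eigenvector of the product in reverse order, with eigenvalue
   smaller by [a]. *)
have /eqP := heis_e_swap (i := i.+1%:Z) v isT.
rewrite Wi -subr_eq => /eqP <-.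
by rewrite -scalerBl linearZ /= rmorphD mulrDr mulr1 opprD addrA.
Qed.

Lemma weight_space_lower (j : nat) k v : weight_space k v ->
  weight_space (k - << j >>) (act (heis_e K (- j.+1%:Z)) v).
Proof.
move=> Wv i; rewrite /weight mcoeffB mcoeffU; move: (Wv i).
rewrite /number_op /= /weight => Wi.
case: (eqVneq j i) => [-> | ji]; last first.
  rewrite mulr0n subr0 (heis_e_comm (i := - _) (j := - j.+1%:Z)) //.
  rewrite heis_e_comm ?Wi ?linearZ //.
  by rewrite subr_eq0 eqz_nat eqSS eq_sym.
(* Swapping the two outer factors puts [number_op i] next to [v] and adds [a] to the eigenvalue. *)
rewrite heis_e_swap // Wi linearZ /= -scalerDl.
by rewrite rmorphB mulrBr mulr1 opprB addrA addrAC.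
Qed.

End HeisenbergAction.

Theorem theorem4p5 (R : realType) (V : lieModule (heisenberg R[i])) :
  Z_graded V ->
  irreducible_module V ->
  diagonal_module V ->
  (exists2 a : R[i], a != 0 & has_level V a) ->
  exists W : Zinf -> set V, is_Zinf_gradation W.
Proof.
move=> _ [_ irrV] [v0 nz_v0 diag_v0] [a nz_a levelV].
have [|lam Dlam] := @choice _ _ (fun i b => number_op V i v0 = b *: v0).
  by move=> i; apply: diag_v0.
pose W := @weight_space _ V a lam; exists W.
have subW k : subspace (W k) by apply: joint_eigenspace_subspace.
have Wup j k v : W k v -> W (k + << j >>) (act (heis_e _ j.+1%:Z) v).
  exact: weight_space_raise.
have Wdown j k v : W k v -> W (k - << j >>) (act (heis_e _ (- j.+1%:Z)) v).
  exact: weight_space_lower.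
have weight_sep k l : k != l -> exists i, weight a lam i k != weight a lam i l.
  (* Equal weights force equal entries: [a] is nonzero and the integers embed in [R[i]]. *)
  move=> kl; apply: contrapT => same; case/eqP: kl; apply/malgP => i.
  apply: contrapT => kli; apply: same; exists i; apply/eqP => /addrI /oppr_inj.
  by move/(mulfI nz_a)/intr_inj.
split=> [|j k v Wv]; last by split; [apply: Wup | apply: Wdown].
apply: direct_sum_span => // [f g|v]; first exact: joint_eigenspace_inj.
(* [U] is the sum of all the [W k]; it remains to see that it is a nonzero submodule. *)
pose U : set V := fun u => exists2 s : seq V,
  forall x, x \in s -> exists k, W k x & u = \sum_(x <- s) x.
(* Scalings and the [e_i] both send each [W k] into some [W l], so one argument serves for both. *)
have U_map (F : {linear V -> V}) u :
    (forall k x, W k x -> exists l, W l (F x)) -> U u -> U (F u).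
  move=> WF [s Ws ->]; exists (map F s) => [y /mapP[x /Ws[k Wx] ->]|].
    exact: WF Wx.
  by rewrite linear_sum big_map.
have UZ b u : U u -> U (b *: u).
  apply: (U_map ( *:%R b : {linear V -> V})) => k x Wx; exists k => /=.
  by rewrite -[b *: x]addr0; apply: (subW k).2 => //; apply: (subW k).1.
have subU : subspace U.
  split=> [|b u w /(UZ b)[s Ws ->] [t Wt ->]].
    by exists [::]; rewrite ?big_nil.
  by exists (s ++ t) => [x|]; rewrite ?big_cat // mem_cat => /orP[/Ws|/Wt].
have Ue i u : i != 0 -> U u -> U (act (heis_e _ i) u).
  (* The nonzero integers are [j.+1] and [- j.+1], matching the raising and lowering operators at
     position [j]. *)
  move=> nz_i; apply: U_map => k x Wx; case: i nz_i => [[|j]|j] // _.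
    by exists (k + << j >>); apply: Wup.
  by exists (k - << j >>); apply: Wdown.
have Uv0 : U v0.
  exists [:: v0] => [x|]; last by rewrite big_seq1.
  (* As [lam] lists the eigenvalues of [v0] itself, [v0] has index 0. *)
  rewrite inE => /eqP ->; exists 0 => i.
  by rewrite Dlam /weight mcoeff0 mulr0 subr0.
have [U0|UT] := irrV U (submodule_heis_e levelV subU Ue).
  by case/eqP: nz_v0; rewrite U0 in Uv0.
by change (U v); rewrite UT.
Qed.
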